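(* Let $\nu>0$, $\Delta t>0$, $\varepsilon>0$, let $u_R^0\in X_R$, $p_M^0\in Q_M$, and let $(u_R^{n},p_M^{n})_{n\ge 1}\subset X_R\times Q_M$ satisfy the AC-ROM scheme: for all $n\ge 0$, $$\Big(\frac{u^{n+1}_R - u^{n}_R}{\Delta t}, \varphi \Big) + b^{\ast}(u_R^{n} , u^{n+1}_R ,\varphi) +\nu (\nabla u^{n+1}_R, \nabla \varphi) - (p^{n+1}_M , \nabla \cdot \varphi) =( f^{n+1}, \varphi) \qquad \forall \varphi \in X_R,$$ $$\varepsilon \Big(\frac{p_{M}^{n+1} - p_{M}^{n}}{\Delta t}, \psi \Big) + (\nabla \cdot u_R^{n+1}, \psi )= 0 \qquad \forall \psi \in Q_M.$$ Then for every $N\ge 0$ the energy equality $$\|u_R^{N+1}\|^2+\varepsilon \|p_M^{N+1}\|^2+\sum_{n=0}^N\left(\|u_R^{n+1}-u_R^{n}\|^2+\varepsilon\|p_M^{n+1}-p_M^{n}\|^2\right)+2\Delta t\,\nu\sum_{n=0}^{N}\|\nabla u_R^{n+1}\|^2 = \|u_R^0\|^2+\varepsilon \|p_M^0\|^2+2\Delta t\sum_{n=0}^{N}(f^{n+1},u_R^{n+1})$$ and the energy inequality $$\|u_R^{N+1}\|^2+\varepsilon\|p_M^{N+1}\|^2+\sum_{n=0}^N\left(\|u_R^{n+1}-u_R^{n}\|^2+\varepsilon\|p_M^{n+1}-p_M^{n}\|^2\right)+\Delta t\,\nu\sum_{n=0}^{N}\|\nabla u_R^{n+1}\|^2 \leq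 \|u_R^0\|^2+\varepsilon\|p_M^0\|^2+\frac{4\Delta t}{\nu}\sum_{n=0}^{N}\|f^{n+1}\|_{-1}^2$$ hold.
   Context: $\Omega\subset\mathbb{R}^d$ ($d=2,3$) is a bounded domain, regular enough for the standard Sobolev embeddings; $(\cdot,\cdot)$ and $\|\cdot\|$ are the $L^2(\Omega)$ inner product and norm (also for vector- and matrix-valued functions). $X=[H^1_0(\Omega)]^d$, $Q=L^2_0(\Omega)=\{q\in L^2(\Omega):\int_\Omega q\,dx=0\}$. The dual norm is $\|f\|_{-1}=\sup_{0\ne v\in X}\frac{(f,v)}{\|\nabla v\|}$. The explicitly skew-symmetric trilinear form is $$b^{\ast}(w,u,v)=\tfrac12(w\cdot\nabla u,v)-\tfrac12(w\cdot\nabla v,u),\qquad u,v,w\in[H^1(\Omega)]^d.$$ $f$ is the body force, with values in $[L^2(\Omega)]^d$, and $f^{n}=f(t_n)$, $t_n=n\Delta t$, at the time levels used; $\nu$ is the kinematic viscosity and $\varepsilon$ the artificial compression parameter. $X_h\subset X$ and $Q_h\subset Q$ are conforming finite element spaces on a regular triangulation of $\Omega$. $X_R=\mathrm{span}\{\varphi_i\}_{i=1}^R\subset X_h$ and $Q_M=\mathrm{span}\{\psi_i\}_{i=1}^M\subset Q_h$ are the finite-dimensional proper orthogonal decomposition (POD) spaces: given finitely many velocity snapshots in $X_h$ and pressure snapshots in $Q_h$ (coming from a finite element artificial compression discretization of the Navier-Stokes equations), $\{\varphi_i\}$ (resp. $\{\psi_i\}$) is an $L^2$-orthonormal family minimizing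 the sum over velocity snapshots $u_{h,S}^n$ (resp. pressure snapshots $p_{h,S}^n$) of $\|u_{h,S}^n-\sum_{j=1}^R(u_{h,S}^n,\varphi_j)\varphi_j\|^2$ (resp. $\|p_{h,S}^n-\sum_{j=1}^M(p_{h,S}^n,\psi_j)\psi_j\|^2$). No inf-sup condition and no weak divergence-freeness is assumed for $(X_R,Q_M)$. *)

(* Defs.v *)
From HB Require Import structures.
From mathcomp Require Import all_boot all_order all_algebra.
From mathcomp Require Import all_classical all_reals all_analysis.

Set Implicit Arguments.
Unset Strict Implicit.
Unset Printing Implicit Defensive.
Import Order.TTheory GRing.Theory Num.Theory.
Import numFieldNormedType.Exports.

Local Open Scope classical_set_scope.
Local Open Scope ring_scope.

(* Functions, scalar or vector valued, are representatives of their L^2-classes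
   defined on all of R^d; only their restriction to Omega matters. *)

Definition rv_display : measure_display.
Proof. exact: default_measure_display. Qed.

(* R^n carries the sigma-algebra generated by its coordinates, i.e. the Borel
   sigma-algebra. *)
Section measurable_rV.
Variables (R : realType) (n : nat).

Definition rv_coord (i : 'I_n) (v : 'rV[R]_n) : measurableTypeR R := v ord0 i.

Let rv_set0 : g_sigma_preimage rv_coord set0.
Proof. exact: sigma_algebra0. Qed.

Let rv_setC A : g_sigma_preimage rv_coord A -> g_sigma_preimage rv_coord (~` A).
Proof. exact: sigma_algebraC. Qed.

Let rv_bigcup (F : _^nat) : (forall i, g_sigma_preimage rv_coord (F i)) ->
  g_sigma_preimage rv_coord (\bigcup_i (F i)).
Proof. exact: sigma_algebra_bigcup. Qed.

HB.instance Definition _ := @isMeasurable.Build rv_display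
  'rV[R]_n (g_sigma_preimage rv_coord) rv_set0 rv_setC rv_bigcup.

Lemma measurable_rv_coord (i : 'I_n) : measurable_fun setT (rv_coord i).
Proof.
move=> _ Y mY; rewrite setTI; apply: sub_sigma_algebra => /=.
rewrite -bigcup_seq/=; exists i => /=; first by rewrite mem_index_enum.
by exists Y => //; rewrite setTI.
Qed.

Lemma measurable_fun_rV d (T : measurableType d) (f : T -> 'rV[R]_n) :
  (forall i, measurable_fun setT (rv_coord i \o f)) -> measurable_fun setT f.
Proof.
move=> mf.
have h : g_sigma_preimage (fun i => rv_coord i \o f) `<=` measurable.
  apply: smallest_sub; first exact: sigma_algebra_measurable.
  move=> A; rewrite -bigcup_seq/= => -[i _ [B mB <-]].
  exact: mf.
move: h; rewrite g_sigma_preimage_comp => h.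
by move=> _ A mA; apply: h; exists A.
Qed.

End measurable_rV.

Section lebesgue_rV.
Variable R : realType.

Definition rv_cons n (x : measurableTypeR R * 'rV[R]_n) : 'rV[R]_n.+1 :=
  \row_i oapp (x.2 ord0) x.1 (unlift ord0 i).

Definition rv_uncons n (v : 'rV[R]_n.+1) : measurableTypeR R * 'rV[R]_n :=
  (v ord0 ord0, \row_i v ord0 (lift ord0 i)).

Lemma rv_consK n : cancel (@rv_cons n) (@rv_uncons n).
Proof.
move=> [s v]; rewrite /rv_uncons; congr pair; first by rewrite mxE unlift_none.
by apply/rowP => i; rewrite !mxE liftK.
Qed.

Lemma measurable_rv_cons n : measurable_fun setT (@rv_cons n).
Proof.
apply: measurable_fun_rV => i; case: (unliftP ord0 i) => [j|] ->.
  rewrite (_ : _ \o _ = @rv_coord R n j \o snd).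
    apply: measurableT_comp => //; exact: measurable_rv_coord.
  by apply/funext => x /=; rewrite /rv_coord mxE liftK.
rewrite (_ : _ \o _ = fst)//.
by apply/funext => x /=; rewrite /rv_coord mxE unlift_none.
Qed.

Lemma measurable_rv_uncons n : measurable_fun setT (@rv_uncons n).
Proof.
apply: (@measurable_fun_pair _ _ _ _ _ _ (@rv_coord R n.+1 ord0)).
  exact: measurable_rv_coord.
apply: measurable_fun_rV => i.
rewrite (_ : _ \o _ = @rv_coord R n.+1 (lift ord0 i)).
  exact: measurable_rv_coord.
by apply/funext => v /=; rewrite /rv_coord mxE.
Qed.

Section step.
Variables (n : nat) (m : {sigma_finite_measure set 'rV[R]_n -> \bar R}).

Definition leb_step : set 'rV[R]_n.+1 -> \bar R :=
  pushforward (@lebesgue_measure R \x m)%E (@rv_cons n).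

Let leb_step0 : leb_step set0 = 0%E.
Proof. by rewrite /leb_step /pushforward preimage_set0 measure0. Qed.

Let leb_step_ge0 A : (0 <= leb_step A)%E.
Proof. by rewrite /leb_step /pushforward; exact: measure_ge0. Qed.

Let leb_step_sigma_additive : semi_sigma_additive leb_step.
Proof.
move=> F mF tF mUF; rewrite /leb_step /pushforward preimage_bigcup.
apply: measure_semi_sigma_additive.
- by move=> k; rewrite -[X in measurable X]setTI; exact: measurable_rv_cons.
- apply/trivIsetP => /= i j _ _ ij; rewrite -preimage_setI.
  by move/trivIsetP : tF => /(_ _ _ _ _ ij) ->//; rewrite preimage_set0.
- rewrite -preimage_bigcup -[X in measurable X]setTI.
  exact: measurable_rv_cons.
Qed.

HB.instance Definition _ := isMeasure.Build _ _ _ leb_step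
  leb_step0 leb_step_ge0 leb_step_sigma_additive.

Lemma leb_step_sigma_finite : sigma_finite setT leb_step.
Proof.
have /sigma_finiteP[F [TF ndF Foo]] := sigma_finiteT (@lebesgue_measure R).
have /sigma_finiteP[G [TG ndG Goo]] := sigma_finiteT m.
exists (fun k => @rv_uncons n @^-1` (F k `*` G k)).
  rewrite -preimage_bigcup -[LHS](preimage_setT (@rv_uncons n)); congr (_ @^-1` _).
  rewrite -setXTT TF TG predeqE => -[x y]; split.
    move=> [/= [k _ Fkx] [l _ Gly]]; exists (maxn k l) => //; split.
    - by move: x Fkx; exact/subsetPset/ndF/leq_maxl.
    - by move: y Gly; exact/subsetPset/ndG/leq_maxr.
  by move=> [k _ []/= ? ?]; split; exists k.
move=> k; have [mFk Fk] := Foo k; have [mGk Gk] := Goo k; split.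
  rewrite -[X in measurable X]setTI; apply: measurable_rv_uncons => //.
  exact: measurableX.
rewrite /leb_step /pushforward -comp_preimage (_ : _ \o _ = id)//=; last first.
  by apply/funext => x /=; rewrite rv_consK.
rewrite preimage_id product_measure1E// lte_mul_pinfty// ge0_fin_numE//.
Qed.

HB.instance Definition _ := Measure_isSigmaFinite.Build _ _ _ leb_step
  leb_step_sigma_finite.

End step.

(* d-dimensional Lebesgue measure, as the iterated product of the
   one-dimensional one. *)
Fixpoint leb (n : nat) : {sigma_finite_measure set 'rV[R]_n -> \bar R} :=
  match n with
  | 0 => \d_ (0 : 'rV[R]_0)
  | k.+1 => leb_step (leb k)
  end.

End lebesgue_rV.
Arguments leb {R} n.

Section test_functions.
Variables (R : realType) (d : nat).
Implicit Types (phi : 'rV[R]_d -> R) (Omega : set 'rV[R]_d).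

Definition pder (i : 'I_d) phi : 'rV[R]_d -> R :=
  fun x => 'D_(delta_mx ord0 i) phi x.

Definition smooth phi := forall s : seq 'I_d,
  continuous (foldr pder phi s) /\
  forall i x, derivable (foldr pder phi s) x (delta_mx ord0 i).

Definition fsupport phi : set 'rV[R]_d := closure [set x | phi x != 0].

Definition test_function Omega phi :=
  [/\ smooth phi, compact (fsupport phi) & fsupport phi `<=` Omega].

End test_functions.

Section domains.
Variables (R : realType) (d : nat).

Definition bounded_domain (Omega : set 'rV[R]_d) :=
  [/\ open Omega, connected Omega, Omega !=set0 & bounded_set Omega].

End domains.

Section function_spaces.
Variables (R : realType) (d : nat) (Omega : set 'rV[R]_d).
Local Notation Rd := 'rV[R]_d.
Local Notation mu := (leb d).

Definition L2 (u : Rd -> R) :=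
  measurable_fun Omega u /\ mu.-integrable Omega (fun x => (u x ^+ 2)%:E).

(* g is an L^2 weak i-th partial derivative of u *)
Definition weak_pder (i : 'I_d) (u g : Rd -> R) :=
  L2 g /\ forall phi, test_function Omega phi ->
    \int[mu]_(x in Omega) (u x * pder i phi x) =
    - \int[mu]_(x in Omega) (g x * phi x).

(* A weak derivative is unique up to a null set; wpder picks a representative
   (and is the zero function when there is none). *)
Definition wpder (i : 'I_d) (u : Rd -> R) : Rd -> R :=
  xget (cst 0) (weak_pder i u).

Definition H1 (u : Rd -> R) := L2 u /\ forall i, exists g, weak_pder i u g.

Definition H1norm (u : Rd -> R) : R := Num.sqrt
  (\int[mu]_(x in Omega) (u x ^+ 2) +
   \sum_i \int[mu]_(x in Omega) (wpder i u x ^+ 2)).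

Definition H10 (u : Rd -> R) := H1 u /\
  forall e : R, 0 < e -> exists2 phi, test_function Omega phi &
    H1norm (u \- phi) < e.

Definition vL2 (u : Rd -> Rd) := forall j, L2 (fun x => u x ord0 j).

Definition X (u : Rd -> Rd) := forall j, H10 (fun x => u x ord0 j).

Definition Q (q : Rd -> R^o) := L2 q /\ \int[mu]_(x in Omega) q x = 0.

Definition dotL2 (p q : Rd -> R^o) : R := \int[mu]_(x in Omega) (p x * q x).

Definition mdotL2 m n (F G : Rd -> 'M[R]_(m, n)) : R :=
  \int[mu]_(x in Omega) \sum_i \sum_j (F x i j * G x i j).

Definition normL2 (p : Rd -> R^o) : R := Num.sqrt (dotL2 p p).

Definition mnormL2 m n (F : Rd -> 'M[R]_(m, n)) : R := Num.sqrt (mdotL2 F F).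

(* (grad u x) i j is the i-th derivative of the j-th component, so that the row
   vector w x *m grad u x is (w . nabla) u at x. *)
Definition grad (u : Rd -> Rd) : Rd -> 'M[R]_d :=
  fun x => \matrix_(i, j) wpder i (fun y => u y ord0 j) x.

Definition div (u : Rd -> Rd) : Rd -> R^o := fun x => \tr (grad u x).

Definition convect (w u : Rd -> Rd) : Rd -> Rd := fun x => w x *m grad u x.

Definition bstar (w u v : Rd -> Rd) : R :=
  2^-1 * mdotL2 (convect w u) v - 2^-1 * mdotL2 (convect w v) u.

(* When Omega is bounded, the Poincare inequality bounds this set of reals, so
   that the real-valued sup is the supremum. *)
Definition dual_norm (f : Rd -> Rd) : R :=
  sup [set mdotL2 f v / mnormL2 (grad v) |
    v in [set v | X v /\ ~ ae_eq mu Omega v (cst 0)]].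

(* The embeddings of H^1 into L^q: q < oo when d = 2, q <= 6 when d = 3. *)
Definition sobolev_embeddings := forall q : R, 1 <= q ->
  (d = 3%N -> q <= 6) ->
  exists C : R, forall u, H1 u ->
    ((\int[mu]_(x in Omega) (`|u x| `^ q)%:E) `^ q^-1 <= (C * H1norm u)%:E)%E.

End function_spaces.

Section finite_elements.
Variables (R : realType) (d : nat).
Local Notation Rd := 'rV[R]_d.

(* Barycentric coordinates with respect to the reference simplex with vertices
   0 (index None) and e_i (index Some i). *)
Definition bary (x : Rd) (k : option 'I_d) : R :=
  if k is Some i then x ord0 i else 1 - \sum_i x ord0 i.

Definition ref_simplex : set Rd := [set x | forall k, 0 <= bary x k].

Definition ref_interior : set Rd := [set x | forall k, 0 < bary x k].

Definition ref_face (S : {set option 'I_d}) : set Rd :=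
  [set x | ref_simplex x /\ forall k, k \notin S -> bary x k = 0].

(* Cells are images of the reference simplex.  With affine charts these are
   ordinary simplices; charts are not required to be affine, so that Omega is
   not forced to be polyhedral. *)
Record mesh := Mesh {
  ncells : nat;
  chart : 'I_ncells -> Rd -> Rd }.

Definition cell (T : mesh) (j : 'I_(ncells T)) : set Rd :=
  chart j @` ref_simplex.

(* For one finite mesh, shape regularity amounts to a bi-Lipschitz bound on
   each chart. *)
Definition regular_triangulation (Omega : set Rd) (T : mesh) :=
  [/\ forall j : 'I_(ncells T), exists2 s : R, 0 < s & forall x y,
        ref_simplex x -> ref_simplex y ->
        s^-1 * `|x - y| <= `|chart j x - chart j y| <= s * `|x - y|,
      forall j k : 'I_(ncells T), j != k -> exists S S' : {set option 'I_d},
        [/\ S != [set: option 'I_d]%SET,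
            cell j `&` cell k = chart j @` ref_face S &
            cell j `&` cell k = chart k @` ref_face S'] &
      \bigcup_(j in [set: 'I_(ncells T)]) cell j = closure Omega].

Definition polynomial_fun (p : Rd -> R) :=
  exists k (c : {ffun 'I_d -> 'I_k} -> R),
    forall x, p x = \sum_a c a * \prod_i x ord0 i ^+ a i.

Definition piecewise_polynomial (T : mesh) (u : Rd -> R) :=
  forall j : 'I_(ncells T), exists2 p, polynomial_fun p &
    forall x, ref_interior x -> u (chart j x) = p x.

Definition lspan (V : lmodType R) n (b : 'I_n -> Rd -> V) : set (Rd -> V) :=
  [set u | exists c : 'I_n -> R, u = fun x => \sum_i c i *: b i x].

Definition finite_element_space (V : lmodType R) (P : set (Rd -> V))
    (W Wh : set (Rd -> V)) :=
  [/\ exists n (b : 'I_n -> Rd -> V), Wh = lspan b, Wh `<=` W & Wh `<=` P].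

Definition velocity_fe_space (Omega : set Rd) (T : mesh) :=
  finite_element_space
    [set u : Rd -> Rd | forall j, piecewise_polynomial T (fun x => u x ord0 j)]
    (X Omega).

Definition pressure_fe_space (Omega : set Rd) (T : mesh) :=
  finite_element_space (V := R^o) (piecewise_polynomial T) (Q Omega).

End finite_elements.

Section POD.
Variables (R : realType) (d : nat) (V : lmodType R).
Variable ip : ('rV[R]_d -> V) -> ('rV[R]_d -> V) -> R.

(* ip is the L^2 inner product and Wh the finite element space; Wh is also the
   range of the competing orthonormal families. *)
Definition orthonormal_family r (phi : 'I_r -> 'rV[R]_d -> V) :=
  forall i j, ip (phi i) (phi j) = (i == j)%:R.

Definition POD_error K (S : 'I_K -> 'rV[R]_d -> V) r
    (phi : 'I_r -> 'rV[R]_d -> V) : R :=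
  let e n := fun x => S n x - \sum_j ip (S n) (phi j) *: phi j x in
  \sum_n ip (e n) (e n).

Definition POD_basis (Wh : set ('rV[R]_d -> V)) K (S : 'I_K -> 'rV[R]_d -> V) r
    (phi : 'I_r -> 'rV[R]_d -> V) :=
  [/\ forall i, Wh (phi i), orthonormal_family phi &
      forall chi : 'I_r -> 'rV[R]_d -> V, (forall i, Wh (chi i)) ->
        orthonormal_family chi -> POD_error S phi <= POD_error S chi].

End POD.

(* Main.v *)
Require Import Defs.
From mathcomp Require Import all_boot all_order all_algebra.
From mathcomp Require Import all_classical all_reals all_analysis.
From mathcomp Require Import measurable_realfun ring lra.
Import Order.TTheory GRing.Theory Num.Theory.
Import numFieldNormedType.Exports.
Local Open Scope classical_set_scope.
Local Open Scope ring_scope.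

(* Testing the momentum equation with u^{n+1} kills the skew-symmetric term, and
   testing the continuity equation with p^{n+1} eliminates the pressure term; the
   polarization identity 2 (a - b, a) = |a|^2 - |b|^2 + |a - b|^2 then gives one
   step of the energy equality, which telescopes.  For the inequality, the power
   of the force is split by Young's inequality.  Because the real-valued dual norm
   is 0 when its set of quotients is unbounded, (f, v) <= |f|_{-1} |grad v|
   requires the Poincare inequality on X, proved by testing the weak derivative of
   a test function phi against x_0 phi. *)

(** * Borel sets of R^d and finiteness of Lebesgue measure on bounded sets *)

Section rV_borel.
Context {R : realType} {d : nat}.
Local Notation Rd := 'rV[R]_d.

Lemma measurable_rV_box (c : Rd) (e : R) :
  measurable [set v : Rd | forall i, ball (c ord0 i) e (v ord0 i)].
Proof.
rewrite (_ : [set _ | _] =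
    \bigcap_(i in [set: 'I_d]) (@rv_coord R d i @^-1` ball (c ord0 i) e)).
  apply: fin_bigcap_measurable => [|i _]; first exact: finite_finset.
  rewrite -[X in measurable X]setTI; apply: measurable_rv_coord => //.
  exact: measurable_ball.
by apply/seteqP; split=> [v vc i _|v vc i]; [exact: vc|exact: (vc i I)].
Qed.

(** The sigma-algebra is generated by the coordinates, not by the topology. The bridge is second
    countability: [O] is the union of the boxes inside it that have rational centres and radii
    1/(k+1), and these are countably many. *)
Lemma open_measurable_rV (O : set Rd) : open O -> measurable O.
Proof.
move=> oO.
pose B (qk : 'rV[rat]_d * nat) : set Rd :=
  [set v | forall i, ball (map_mx ratr qk.1 ord0 i : R) (qk.2.+1%:R^-1) (v ord0 i)].
(* Boxes not contained in [O] are replaced by the empty set, so that the union runs over a whole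
   countable type. *)
rewrite (_ : O = \bigcup_(qk in [set: 'rV[rat]_d * nat])
    (if `[< B qk `<=` O >] then B qk else set0)); last first.
  apply/seteqP; split=> [x Ox|x [qk _]]; last first.
    by case: asboolP => // BO /BO.
  have [e /= e0 xeO] := (@nbhs_ballP R Rd x O).1 (open_nbhs_nbhs (conj oO Ox)).
  (* With radius below e / 2, a box whose centre is within that radius of [x] stays in the [e]-ball
     around [x]. *)
  have [k ke] : exists k : nat, k.+1%:R^-1 < e / 2 :> R.
    have [k _ /(_ k (leqnn k))] := near_infty_natSinv_lt (PosNum (divr_gt0 e0 (ltr0Sn R 1))).
    by exists k.
  have h i : exists q : rat, ball (ratr q : R) (k.+1%:R^-1) (x ord0 i).
    have [|q] := @rat_in_itvoo R (x ord0 i - k.+1%:R^-1) (x ord0 i + k.+1%:R^-1).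
      by rewrite ltrBlDr -addrA ltrDl addr_gt0// invr_gt0.
    rewrite in_itv/= => /andP[q1 q2]; exists q.
    rewrite /ball/= ltr_norml; move: q1 q2; set t := ratr q : R.
    by move: k.+1%:R^-1 => /= a q1 q2; apply/andP; split; lra.
  pose q := \row_i xchoose (h i).
  have xB : B (q, k) x by move=> i /=; rewrite !mxE; exact: (xchooseP (h i)).
  exists (q, k) => //; case: asboolP => // -[] y By; apply: xeO.
  rewrite /ball/=; split=> // i j; rewrite (ord1 i).
  have := xB j; have := By j.
  rewrite /ball/= => /ltr_normlP[] + + /ltr_normlP[].
  move: ke; move: k.+1%:R^-1 (map_mx _ _ _ _) => /= a b *.
  by rewrite ltr_norml; apply/andP; split; lra.
apply: countable_bigcupT_measurable => // qk.
by case: asboolP => // _; exact: measurable_rV_box.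
Qed.

Lemma continuous_measurable_rV (f : Rd -> R) :
  continuous f -> measurable_fun [set: Rd] f.
Proof.
move=> cf; apply: (measurability _ (RGenOpens.measurableE R)) => //.
move=> _ [_ [a [b ->]] <-]; rewrite setTI; apply: open_measurable_rV.
by apply: open_comp => // x _; exact: cf.
Qed.

End rV_borel.

(** Induction on the dimension: under [rv_cons] a box pulls back to an interval times a box of one
    dimension less, so its measure is a product of two finite factors. In dimension 0 the measure is
    a Dirac mass. *)
Lemma leb_box_lty (R : realType) (d : nat) (B : R) :
  (leb d [set v : 'rV[R]_d | forall i, ball (0 : R)%R B (v ord0 i)] < +oo)%E.
Proof.
elim: d => [|d IHd]; first by rewrite /= diracE; case: (_ \in _) => /=; rewrite ltry.
rewrite /= /leb_step /pushforward.
rewrite (_ : _ @^-1` _ =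
   ball (0 : R) B `*` [set v : 'rV[R]_d | forall i, ball (0 : R) B (v ord0 i)]); last first.
  apply/seteqP; split=> [[s v] /= h|[s v] /= [hs hv] i].
    split=> [|i]; first by have := h ord0; rewrite mxE unlift_none.
    by have := h (lift ord0 i); rewrite mxE liftK.
  by rewrite mxE; case: (unliftP ord0 i) => [j|] _ //=; exact: hv.
rewrite product_measure1E//; last 2 first.
  exact: measurable_ball.
  rewrite (_ : [set _ | _] =
    [set v : 'rV[R]_d | forall i, ball ((0 : 'rV[R]_d) ord0 i) B (v ord0 i)]).
    exact: measurable_rV_box.
  by apply/seteqP; split=> v h i; have := h i; rewrite mxE.
rewrite lte_mul_pinfty// ge0_fin_numE//.
(* For negative [B] the ball is empty; the length formula is for nonnegative radii. *)
case: (leP 0 B) => [B0|/ltW B0]; last by rewrite ((ball0 _ _).2 _)// measure0.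
by rewrite [ltLHS](lebesgue_measure_ball _ B0) ltry.
Qed.

Lemma leb_bounded_lty (R : realType) (d : nat) (D : set 'rV[R]_d) :
  measurable D -> bounded_set D -> (leb d D < +oo)%E.
Proof.
move=> mD /ex_strict_bound_gt0[M M0 DM].
apply: le_lt_trans (leb_box_lty R d M).
apply: le_measure; rewrite ?inE//.
  rewrite (_ : [set _ | _] =
    [set v : 'rV[R]_d | forall i, ball ((0 : 'rV[R]_d) ord0 i) M (v ord0 i)]).
    exact: measurable_rV_box.
  by apply/seteqP; split=> v h i; have := h i; rewrite mxE.
move=> v /DM /= vM i.
have : ball (0 : 'rV[R]_d) M v by rewrite mx_norm_ball /ball_ /= sub0r normrN.
by case=> _ /(_ ord0 i); rewrite mxE.
Qed.

(** * Algebra of the L^2 inner products *)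

Lemma quadratic_ge0_discr {R : realFieldType} (a b c : R) : 0 <= c ->
  (forall t, 0 <= a + 2 * t * b + t ^+ 2 * c) -> b ^+ 2 <= a * c.
Proof.
rewrite le_eqVlt => /predU1P[<-|c0] abc.
  have [->|b0] := eqVneq b 0; first by rewrite expr0n/= mulr0.
  (* For c = 0 the expression is affine in [t]; with nonzero slope it takes the value -1 here. *)
  have := abc (- (a + 1) / (2 * b)).
  by rewrite (_ : _ + _ = -1); [rewrite oppr_ge0 ler10|field].
(* The minimizer in [t]. *)
have := abc (- b / c); rewrite (_ : _ + _ = (a * c - b ^+ 2) / c); last first.
  by field; rewrite gt_eqF.
by rewrite pmulr_lge0 ?invr_gt0// subr_ge0.
Qed.

Section L2_algebra.
Context {R : realType} {d : nat} {Omega : set 'rV[R]_d}.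
Hypothesis mOmega : measurable Omega.
Local Notation Rd := 'rV[R]_d.
Local Notation mu := (leb d).
Implicit Types (f g h : Rd -> R).

(** Domination: |f g| <= f^2 + g^2 pointwise. *)
Lemma L2_integrable_mul f g : L2 Omega f -> L2 Omega g ->
  mu.-integrable Omega (EFin \o (fun x => f x * g x)).
Proof.
move=> [mf f2] [mg g2].
apply: (le_integrable mOmega) (integrableD mOmega f2 g2).
  by apply/measurable_EFinP; exact: measurable_funM.
move=> x _ /=; rewrite lee_fin normrM [leRHS]ger0_norm ?addr_ge0 ?sqr_ge0//.
rewrite -(real_normK (num_real (f x))) -(real_normK (num_real (g x))).
by have := sqr_ge0 (`|f x| - `|g x|); have := sqr_ge0 (`|f x| + `|g x|); nra.
Qed.

Lemma L2D f g : L2 Omega f -> L2 Omega g -> L2 Omega (fun x => f x + g x).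
Proof.
move=> f2 g2; split; first exact: measurable_funD f2.1 g2.1.
have fg := L2_integrable_mul f g f2 g2.
rewrite (_ : (fun _ => _) =
  ((fun x => (f x ^+ 2)%:E) \+ (fun x => (g x ^+ 2)%:E) \+
   ((EFin \o (fun x => f x * g x)%R) \+ (EFin \o (fun x => f x * g x)%R)))%E).
  apply: integrableD => //; apply: integrableD => //.
  - exact: f2.2.
  - exact: g2.2.
by apply/funext => x /=; rewrite -!EFinD; congr EFin; ring.
Qed.

Lemma L2Z (c : R) f : L2 Omega f -> L2 Omega (fun x => c * f x).
Proof.
move=> [mf f2]; split; first exact: measurable_funM.
rewrite (_ : (fun _ => _) = (fun x => (c ^+ 2)%:E * (f x ^+ 2)%:E)%E).
  exact: integrableZl.
by apply/funext => x; rewrite -EFinM exprMn.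
Qed.

Lemma L2B f g : L2 Omega f -> L2 Omega g -> L2 Omega (fun x => f x - g x).
Proof.
move=> f2 g2; rewrite (_ : (fun _ => _) = (fun x => f x + (-1) * g x)).
  exact/L2D/L2Z.
by apply/funext => x; rewrite mulN1r.
Qed.

Lemma dotL2C f g : dotL2 Omega f g = dotL2 Omega g f.
Proof. by apply: eq_Rintegral => x _; rewrite mulrC. Qed.

Lemma dotL2_ge0 f : 0 <= dotL2 Omega f f.
Proof. by apply: Rintegral_ge0 => x _; rewrite -expr2 sqr_ge0. Qed.

Lemma dotL2Dl f g h : L2 Omega f -> L2 Omega g -> L2 Omega h ->
  dotL2 Omega (fun x => f x + g x) h = dotL2 Omega f h + dotL2 Omega g h.
Proof.
move=> f2 g2 h2; rewrite /dotL2 -RintegralD//; last 2 first.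
- exact: L2_integrable_mul.
- exact: L2_integrable_mul.
by apply: eq_Rintegral => x _; rewrite mulrDl.
Qed.

Lemma dotL2Zl (c : R) f g : L2 Omega f -> L2 Omega g ->
  dotL2 Omega (fun x => c * f x) g = c * dotL2 Omega f g.
Proof.
move=> f2 g2; rewrite /dotL2 -RintegralZl//; last exact: L2_integrable_mul.
by apply: eq_Rintegral => x _; rewrite mulrA.
Qed.

Lemma dotL2_quadratic (u w : Rd -> R) (t : R) : L2 Omega u -> L2 Omega w ->
  dotL2 Omega (fun x => u x + t * w x) (fun x => u x + t * w x) =
  dotL2 Omega u u + 2 * t * dotL2 Omega u w + t ^+ 2 * dotL2 Omega w w.
Proof.
move=> u2 w2; have tw2 := L2Z t w w2; have utw2 := L2D u _ u2 tw2.
rewrite dotL2Dl// dotL2Zl//.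
rewrite !(dotL2C _ (fun x => u x + t * w x)) !dotL2Dl//.
by rewrite !dotL2Zl// (dotL2C w u); ring.
Qed.

(** The parallelogram law, read off from [dotL2_quadratic] at t = 1 and t = -1, with the square of u
    - w dropped. *)
Lemma dotL2D_le (u w : Rd -> R) : L2 Omega u -> L2 Omega w ->
  dotL2 Omega (u \+ w) (u \+ w) <= 2 * dotL2 Omega u u + 2 * dotL2 Omega w w.
Proof.
move=> u2 w2; have := dotL2_quadratic u w 1 u2 w2.
have := dotL2_quadratic u w (-1) u2 w2.
have := dotL2_ge0 (fun x => u x + -1 * w x).
rewrite (_ : (fun x => u x + 1 * w x) = u \+ w); last first.
  by apply/funext => x /=; rewrite mul1r.
set a := dotL2 _ _ _; set b := dotL2 _ (_ \+ _) _; set uu := dotL2 _ u u.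
set uw := dotL2 _ u w; set ww := dotL2 _ w w.
by move=> a0 aE ->; rewrite aE in a0; nra.
Qed.

Lemma dotL2Bl (u w h : Rd -> R) : L2 Omega u -> L2 Omega w -> L2 Omega h ->
  dotL2 Omega (u \- w) h = dotL2 Omega u h - dotL2 Omega w h.
Proof.
move=> u2 w2 h2; rewrite -[X in _ - X]mul1r -mulNr -dotL2Zl//.
rewrite -dotL2Dl//; last exact: L2Z.
by apply: eq_Rintegral => x _ /=; rewrite mulN1r.
Qed.

Section matrix_valued.
Context {m n : nat}.
Implicit Types (F G H : Rd -> 'M[R]_(m, n)).

Definition mL2 F := forall i j, L2 Omega (fun x => F x i j).

Lemma mL2D F G : mL2 F -> mL2 G -> mL2 (fun x => F x + G x).
Proof.
move=> F2 G2 i j; rewrite (_ : (fun _ => _) = (fun x => F x i j + G x i j)).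
  exact: L2D.
by apply/funext => x; rewrite mxE.
Qed.

Lemma mL2Z (c : R) F : mL2 F -> mL2 (fun x => c *: F x).
Proof.
move=> F2 i j; rewrite (_ : (fun _ => _) = (fun x => c * F x i j)).
  exact: L2Z.
by apply/funext => x; rewrite mxE.
Qed.

(** Each product of entries is integrable, so sums and integrals commute; the exchange is made in
    the extended reals, under [fine]. Bilinearity and the backward difference identity reduce to the
    scalar case this way. *)
Lemma mdotL2E F G : mL2 F -> mL2 G -> mdotL2 Omega F G =
  \sum_i \sum_j dotL2 Omega (fun x => F x i j) (fun x => G x i j).
Proof.
move=> F2 G2; rewrite /mdotL2 /Rintegral.
have FG i j : mu.-integrable Omega (fun x => (F x i j * G x i j)%:E).
  exact: L2_integrable_mul.
under eq_integral do rewrite -sumEFin.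
rewrite integral_sum//; last first.
  move=> i; rewrite (_ : (fun _ => _) = (fun x => \sum_j (F x i j * G x i j)%:E)%E).
    exact: integrable_sum.
  by apply/funext => x; rewrite sumEFin.
rewrite -[RHS]/(fine (EFin _)) -sumEFin; congr fine; apply: eq_bigr => i _.
under eq_integral do rewrite -sumEFin.
rewrite integral_sum// -sumEFin; apply: eq_bigr => j _.
by rewrite /dotL2 /Rintegral fineK// integrable_fin_num.
Qed.

Lemma mdotL2C F G : mdotL2 Omega F G = mdotL2 Omega G F.
Proof.
apply: eq_Rintegral => x _; apply: eq_bigr => i _; apply: eq_bigr => j _.
by rewrite mulrC.
Qed.

Lemma mdotL2_ge0 F : 0 <= mdotL2 Omega F F.
Proof.
apply: Rintegral_ge0 => x _; apply: sumr_ge0 => i _; apply: sumr_ge0 => j _.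
by rewrite -expr2 sqr_ge0.
Qed.

Lemma mdotL2Dl F G H : mL2 F -> mL2 G -> mL2 H ->
  mdotL2 Omega (fun x => F x + G x) H = mdotL2 Omega F H + mdotL2 Omega G H.
Proof.
move=> F2 G2 H2; rewrite !mdotL2E//; last exact: mL2D.
rewrite -big_split/=; apply: eq_bigr => i _; rewrite -big_split/=.
apply: eq_bigr => j _; rewrite -dotL2Dl//.
by apply: eq_Rintegral => x _; rewrite mxE.
Qed.

Lemma mdotL2Zl (c : R) F G : mL2 F -> mL2 G ->
  mdotL2 Omega (fun x => c *: F x) G = c * mdotL2 Omega F G.
Proof.
move=> F2 G2; rewrite !mdotL2E//; last exact: mL2Z.
rewrite mulr_sumr; apply: eq_bigr => i _; rewrite mulr_sumr.
apply: eq_bigr => j _; rewrite -dotL2Zl//.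
by apply: eq_Rintegral => x _; rewrite mxE.
Qed.

(** The square of F + t G is a nonnegative quadratic in [t], so its discriminant is nonpositive.
    Definiteness is never invoked, hence null sets cause no trouble. *)
Lemma mdotL2_cauchy_schwarz F G : mL2 F -> mL2 G ->
  mdotL2 Omega F G ^+ 2 <= mdotL2 Omega F F * mdotL2 Omega G G.
Proof.
move=> F2 G2; apply: quadratic_ge0_discr; first exact: mdotL2_ge0.
move=> t; have := mdotL2_ge0 (fun x => F x + t *: G x).
have tG2 := mL2Z t G G2; have FG2 := mL2D F _ F2 tG2.
rewrite mdotL2Dl// mdotL2Zl// !(mdotL2C _ (fun x => F x + t *: G x)).
rewrite !mdotL2Dl// !mdotL2Zl// (mdotL2C G F).
by congr (_ <= _); ring.
Qed.

Lemma mnormL2_sqr F : mnormL2 Omega F ^+ 2 = mdotL2 Omega F F.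
Proof. by rewrite sqr_sqrtr// mdotL2_ge0. Qed.

End matrix_valued.

Lemma normL2_sqr f : normL2 Omega f ^+ 2 = dotL2 Omega f f.
Proof. by rewrite sqr_sqrtr// dotL2_ge0. Qed.

Lemma dotL2_backward_difference (c : R) f g : L2 Omega f -> L2 Omega g ->
  dotL2 Omega (fun x => c *: (f x - g x)) f =
  c / 2 * (dotL2 Omega f f - dotL2 Omega g g +
           dotL2 Omega (f \- g) (f \- g)).
Proof.
move=> f2 g2; have fg2 := L2B f g f2 g2.
rewrite [LHS](dotL2Zl c (f \- g))// !dotL2Bl// !(dotL2C _ (f \- g)) !dotL2Bl//.
by rewrite (dotL2C g f); field.
Qed.

Lemma mdotL2_backward_difference {m n} (c : R) (F G : Rd -> 'M[R]_(m, n)) :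
  mL2 F -> mL2 G ->
  mdotL2 Omega (fun x => c *: (F x - G x)) F =
  c / 2 * (mdotL2 Omega F F - mdotL2 Omega G G +
           mdotL2 Omega (F \- G) (F \- G)).
Proof.
move=> F2 G2; have FG2 : mL2 (F \- G).
  rewrite (_ : _ \- _ = (fun x => F x + (-1) *: G x)).
    exact/mL2D/mL2Z.
  by apply/funext => x; rewrite scaleN1r.
rewrite [LHS](mdotL2Zl c (F \- G))// mdotL2E// !mdotL2E//.
rewrite -sumrB -big_split/= !mulr_sumr; apply: eq_bigr => i _.
rewrite -sumrB -big_split/= !mulr_sumr; apply: eq_bigr => j _.
have := dotL2_backward_difference c _ _ (F2 i j) (G2 i j).
rewrite (dotL2Zl c (fun x => F x i j - G x i j))//; last exact: L2B.
have -> : (fun x => F x i j) \- (fun x => G x i j) = fun x => (F \- G) x i j.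
  by apply/funext => x /=; rewrite !mxE.
move=> <-; congr (_ * dotL2 Omega _ _); apply/funext => x /=; by rewrite !mxE.
Qed.

End L2_algebra.

(** * Smooth functions and test functions *)

Section smooth_functions.
Context {R : realType} {d : nat}.
Local Notation Rd := 'rV[R]_d.
Implicit Types (f g : Rd -> R).

(** A graded form of [smooth]: the product rule turns one derivative into a sum of products, so
    stability under multiplication needs induction on the order rather than on a list of
    directions. *)
Fixpoint smooth_upto (k : nat) f : Prop :=
  [/\ continuous f, forall i x, derivable f x (delta_mx ord0 i) &
      if k is k'.+1 then forall i, smooth_upto k' (pder i f) else True].

Lemma smooth_uptoP f : smooth f <-> forall k, smooth_upto k f.
Proof.
split=> [sf k|sf s].
  elim: k f sf => [|k IHk] f sf /=; first by have [] := sf [::].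
  split; [by have [] := sf [::]|by have [] := sf [::]|move=> i; apply: IHk => s].
  by have := sf (rcons s i); rewrite foldr_rcons.
(* [foldr] applies the last direction of the list first, while [smooth_upto] peels off the innermost
   derivative; hence induction from the end. *)
elim/last_ind: s f sf => [|s i IHs] f sf /=.
  by have [cf df _] := sf 0%N; split.
rewrite foldr_rcons; apply: IHs => k.
by have [_ _ /(_ i)] := sf k.+1.
Qed.

Lemma smooth_uptoW k f : smooth_upto k.+1 f -> smooth_upto k f.
Proof.
elim: k f => [|k IHk] f /= [cf df sf]; split => // i.
by apply: IHk; exact: sf.
Qed.

Lemma pderD i f g : (forall x, derivable f x (delta_mx ord0 i)) ->
  (forall x, derivable g x (delta_mx ord0 i)) ->
  pder i (f + g) = pder i f + pder i g.
Proof. by move=> df dg; apply/funext => x; rewrite /pder deriveD. Qed.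

Lemma pderM i f g : (forall x, derivable f x (delta_mx ord0 i)) ->
  (forall x, derivable g x (delta_mx ord0 i)) ->
  pder i (f * g) = f * pder i g + g * pder i f.
Proof. by move=> df dg; apply/funext => x; rewrite /pder deriveM. Qed.

Lemma smooth_uptoD k f g :
  smooth_upto k f -> smooth_upto k g -> smooth_upto k (f + g).
Proof.
elim: k f g => [|k IHk] f g [cf df sf] [cg dg sg]; split.
- by move=> x; exact: (continuousD (cf x) (cg x)).
- by move=> i x; exact: (derivableD (df i x) (dg i x)).
- exact: I.
- by move=> x; exact: (continuousD (cf x) (cg x)).
- by move=> i x; exact: (derivableD (df i x) (dg i x)).
- move=> i; rewrite (pderD i f g (df i) (dg i)).
  exact: IHk _ _ (sf i) (sg i).
Qed.

(** In the product rule one factor stays undifferentiated; [smooth_uptoW] lowers its order by one to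
    match the induction hypothesis. *)
Lemma smooth_uptoM k f g :
  smooth_upto k f -> smooth_upto k g -> smooth_upto k (f * g).
Proof.
elim: k f g => [|k IHk] f g sf sg;
    have [[cf df sf'] [cg dg sg']] := (sf, sg); split.
- by move=> x; exact: (continuousM (cf x) (cg x)).
- by move=> i x; exact: (derivableM (df i x) (dg i x)).
- exact: I.
- by move=> x; exact: (continuousM (cf x) (cg x)).
- by move=> i x; exact: (derivableM (df i x) (dg i x)).
- move=> i; rewrite (pderM i f g (df i) (dg i)); apply: smooth_uptoD.
  + exact: IHk _ _ (smooth_uptoW k f sf) (sg' i).
  + exact: IHk _ _ (smooth_uptoW k g sg) (sf' i).
Qed.

Lemma smooth_upto_cst k (c : R) : smooth_upto k (cst c).
Proof.
have dc i x : derivable (cst c : Rd -> R) x (delta_mx ord0 i).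
  exact: derivable_cst.
elim: k c dc => [|k IHk] c dc /=; split => //; try by move=> x; exact: cst_continuous.
move=> i; rewrite (_ : pder i _ = cst 0); last first.
  by apply/funext => x; rewrite /pder derive_cst.
by apply: IHk => j x; exact: derivable_cst.
Qed.

Definition coord (j : 'I_d) : Rd -> R := fun x => x ord0 j.

Lemma derivable_coord j x v : derivable (coord j) x v.
Proof. exact/diff_derivable/differentiable_coord. Qed.

Lemma derive_coord j (x v : Rd) : 'D_v (coord j) x = v ord0 j.
Proof.
apply/cvg_lim => //; apply: cvg_trans (cvg_cst (v ord0 j)).
apply: near_eq_cvg; near=> h.
rewrite /coord /= !mxE addrK /GRing.scale/= mulKf//.
  by near: h; exact: nbhs_dnbhs_neq.
exact: dnbhs_filter.
Unshelve. all: by end_near. Qed.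

Lemma smooth_coord j : smooth (coord j).
Proof.
apply/smooth_uptoP; have cc : continuous (coord j) by exact: coord_continuous.
case=> [|k]; split => //; try by move=> i x; exact: derivable_coord.
move=> i; rewrite (_ : pder i _ = cst ((delta_mx ord0 i : Rd) ord0 j)).
  exact: smooth_upto_cst.
by apply/funext => x; rewrite /pder derive_coord.
Qed.

Lemma smoothM f g : smooth f -> smooth g -> smooth (f * g).
Proof.
move=> /smooth_uptoP sf /smooth_uptoP sg; apply/smooth_uptoP => k.
exact: smooth_uptoM.
Qed.

Lemma smooth_continuous f : smooth f -> continuous f.
Proof. by move=> /(_ [::])[]. Qed.

Lemma smooth_derivable f i x : smooth f -> derivable f x (delta_mx ord0 i).
Proof. by move=> /(_ [::])[]. Qed.

Lemma smooth_pder_continuous i f : smooth f -> continuous (pder i f).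
Proof. by move=> /(_ [:: i])[]. Qed.

Lemma out_fsupport_near f x : ~ fsupport f x -> \near x, f x = 0.
Proof.
move=> fx; have : open_nbhs x (~` fsupport f).
  by split=> //; exact/closed_openC/closed_closure.
move=> /open_nbhs_nbhs; apply: filterS => y /= fy; apply: contrapT => /eqP fy0.
by apply: fy; exact: subset_closure.
Qed.

Lemma pder_out_fsupport i f x : ~ fsupport f x -> pder i f x = 0.
Proof.
move=> fx; rewrite /pder (@near_eq_derive _ _ _ f (cst 0)).
  by rewrite derive_cst.
exact: out_fsupport_near.
Qed.

Context {Omega : set Rd}.

Lemma out_fsupport f x : ~ fsupport f x -> f x = 0.
Proof. by move=> /out_fsupport_near /nbhs_singleton. Qed.

(** The support of the product lies in that of [g], so [f] may be a mere coordinate function; this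
    is how x_0 phi becomes a test function. *)
Lemma test_functionMl f g :
  smooth f -> test_function Omega g -> test_function Omega (f * g).
Proof.
move=> sf [sg cg gO].
have fgg : fsupport (f * g) `<=` fsupport g.
  apply: closure_subset => x /=; apply: contra_neq => gx.
  by rewrite /GRing.mul/= gx mulr0.
split; first exact: smoothM.
  exact: (subclosed_compact (@closed_closure _ _) cg fgg).
exact: subset_trans gO.
Qed.

Lemma boundedT_le f (M : R) :
  (forall x, `|f x| <= M) -> [bounded f x | x in setT].
Proof.
move=> fM; exists M; split=> [|N MN x _ /=]; first exact: num_real.
exact: le_trans (fM x) (ltW MN).
Qed.

Lemma continuous_compact_support_bounded f (K : set Rd) : continuous f ->
  compact K -> (forall x, ~ K x -> f x = 0) -> [bounded f x | x in setT].
Proof.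
move=> cf cK fK.
have /compact_bounded/ex_strict_bound_gt0[M M0 fM] : compact (f @` K).
  by apply: continuous_compact => //; exact: continuous_subspaceT.
apply: (boundedT_le f M) => x; have [Kx|nKx] := pselect (K x).
  by apply: ltW; apply: (fM (f x)); exists x.
by rewrite fK// normr0 ltW.
Qed.

Lemma test_function_bounded f : test_function Omega f -> [bounded f x | x in setT].
Proof.
move=> [sf cf _].
exact: continuous_compact_support_bounded (smooth_continuous f sf) cf (out_fsupport f).
Qed.

Lemma test_function_pder_bounded i f :
  test_function Omega f -> [bounded pder i f x | x in setT].
Proof.
move=> [sf cf _].
exact: continuous_compact_support_bounded (smooth_pder_continuous i f sf) cf
  (pder_out_fsupport i f).
Qed.

Hypotheses (mOmega : measurable Omega) (bOmega : bounded_set Omega).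

Lemma continuous_bounded_integrable f : continuous f ->
  [bounded f x | x in setT] -> (leb d).-integrable Omega (EFin \o f).
Proof.
move=> cf bf; apply: measurable_bounded_integrable => //.
- exact: leb_bounded_lty.
- by apply: measurable_funTS; exact: continuous_measurable_rV.
- by apply: sub_boundedr bf => A /= AT x Ox; exact: AT.
Qed.

Lemma continuous_bounded_L2 f : continuous f ->
  [bounded f x | x in setT] -> L2 Omega f.
Proof.
move=> cf bf; split; first by apply: measurable_funTS; exact: continuous_measurable_rV.
apply: (continuous_bounded_integrable (f * f)).
  by move=> x; exact: (continuousM (cf x) (cf x)).
have [M M0 fM] := ex_strict_bound_gt0 bf.
apply: (boundedT_le _ (M * M)) => x.
by rewrite normrM ler_pM// ltW//; exact: fM.
Qed.

Lemma test_function_L2 f : test_function Omega f -> L2 Omega f.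
Proof.
move=> tf; apply: continuous_bounded_L2; last exact: test_function_bounded.
by case: tf => /smooth_continuous.
Qed.

Lemma test_function_pder_L2 i f : test_function Omega f -> L2 Omega (pder i f).
Proof.
move=> tf; apply: continuous_bounded_L2; last exact: test_function_pder_bounded.
by case: tf => /(smooth_pder_continuous i).
Qed.

End smooth_functions.

(** * The integral of a partial derivative of a test function *)

Section integral_of_derivative.
Context {R : realType} {n : nat} {Omega : set 'rV[R]_n.+1}.
Hypotheses (mOmega : measurable Omega) (bOmega : bounded_set Omega).
Local Notation e0 := (delta_mx ord0 ord0 : 'rV[R]_n.+1).
Implicit Types (chi : 'rV[R]_n.+1 -> R) (s : R) (v : 'rV[R]_n).

Lemma rv_cons_line (h s : R) v :
  rv_cons (h + s, v) = h *: e0 + rv_cons (s, v).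
Proof.
apply/rowP => i; rewrite !mxE/=; case: (unliftP ord0 i) => [j|] ->.
  by rewrite /= mulr0 add0r.
by rewrite /= mulr1.
Qed.

Lemma norm_rv_cons_ge s v : `|s| <= `|rv_cons (s, v)|.
Proof.
rewrite [leRHS]mx_normrE.
apply: le_trans (le_bigmax _ _ (ord0, ord0)) => /=.
by rewrite mxE unlift_none.
Qed.

(** Moving the first coordinate is moving along [e0]: both derivatives are limits of the same
    difference quotient. *)
Lemma is_derive_rv_cons chi s v : smooth chi ->
  is_derive s 1 (fun t => chi (rv_cons (t, v))) (pder ord0 chi (rv_cons (s, v))).
Proof.
move=> schi; pose F t := chi (rv_cons (t, v)).
have FE : (fun h : R => h^-1 *: ((F \o shift s) (h *: (1 : R)) - F s)) =
    (fun h : R => h^-1 *: ((chi \o shift (rv_cons (s, v))) (h *: e0) -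
                           chi (rv_cons (s, v)))).
  apply/funext => h /=.
  by rewrite /F [h *: 1]mulr1 rv_cons_line.
apply: DeriveDef; rewrite /derivable /pder /derive -/F FE//.
exact: (smooth_derivable chi ord0).
Qed.

(** A line parallel to [e0] leaves [Omega] outside [-M, M], so the fundamental theorem of calculus
    on this interval leaves only boundary values, which vanish. *)
Lemma integral_pder_line chi v : test_function Omega chi ->
  (\int[lebesgue_measure]_s (pder ord0 chi (rv_cons (s, v)))%:E = 0)%E.
Proof.
move=> [schi _ chiO].
have [M M0 OM] : exists2 M : R, 0 < M & forall x, Omega x -> `|x| < M.
  exact: ex_strict_bound_gt0 bOmega.
(* The strict bound on [Omega] puts the endpoints -M and M themselves outside the support. *)
have out s : M <= `|s| -> ~ fsupport chi (rv_cons (s, v)).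
  move=> Ms /chiO /OM/=; apply/negP; rewrite -leNgt.
  exact: le_trans Ms (norm_rv_cons_ge s v).
pose F (t : R) : R := chi (rv_cons (t, v)).
pose G (t : R) : R := pder ord0 chi (rv_cons (t, v)).
have dF t : is_derive (t : R) (1 : R) F (G t) by exact: is_derive_rv_cons.
have cF : continuous F.
  by move=> t; apply/differentiable_continuous/derivable1_diffP; case: (dF t).
have cG : continuous G.
  move=> t; apply: (@continuous_comp _ _ _ (fun t : R => rv_cons (t, v))); last first.
    exact: (smooth_pder_continuous ord0 chi).
  rewrite (_ : (fun _ => _) = fun t : R => t *: e0 + rv_cons (0, v)).
    by apply: continuousD; [exact: scalel_continuous|exact: cst_continuous].
  by apply/funext => r; rewrite -rv_cons_line addr0.
transitivity (\int[lebesgue_measure]_(s in `[(- M)%R, M]) (G s)%:E)%E.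
  rewrite [RHS]integral_mkcond; apply: eq_integral => s _.
  rewrite patchE; case: ifPn => // /negP; rewrite inE/= in_itv/= => sM.
  congr EFin; apply: pder_out_fsupport; apply: out.
  by rewrite leNgt; apply/negP => /ltW; rewrite ler_norml.
rewrite (@continuous_FTC2 _ G F)//.
- have F0 t : M <= `|t| -> F t = 0 by move=> /(out t)/out_fsupport.
  by rewrite !F0 ?normrN ?ler_norm// sube0.
- by rewrite -subr_gt0 opprK addr_gt0.
- exact: continuous_subspaceT.
- split.
  + by move=> t _; case: (dF t).
  + exact/cvg_at_right_filter/cF.
  + exact/cvg_at_left_filter/cF.
- by move=> t _; rewrite derive1E; case: (dF t).
Qed.

(** Since the derivative vanishes off the support, it can be integrated over the whole space. [leb]
    is there the image of a product measure, and Fubini with coordinate 0 innermost reduces to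
    [integral_pder_line]. *)
Lemma Rintegral_pder chi : test_function Omega chi ->
  \int[leb n.+1]_(x in Omega) pder ord0 chi x = 0.
Proof.
move=> tchi; have [schi _ chiO] := tchi.
pose g := EFin \o pder ord0 chi.
have gE : g = g \_ Omega.
  apply/funext => x; rewrite patchE; case: ifPn => // /negP; rewrite inE => nOx.
  by rewrite /g /= pder_out_fsupport// => /chiO.
have mg : measurable_fun setT g.
  apply/measurable_EFinP; apply: continuous_measurable_rV.
  exact: (smooth_pder_continuous ord0 chi).
have ig : (leb n.+1).-integrable setT g.
  rewrite gE; apply/(integrable_mkcond _ mOmega).
  apply: (continuous_bounded_integrable mOmega bOmega).
    exact: (smooth_pder_continuous ord0 chi).
  exact: test_function_pder_bounded tchi.
rewrite /Rintegral integral_mkcond -/g -gE.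
have mcons := @measurable_rv_cons R n.
have ig' : ((@lebesgue_measure R) \x (leb n))%E.-integrable setT (g \o @rv_cons R n).
  apply/integrableP; split; first exact: measurableT_comp.
  move/integrableP : ig => [_]; apply: le_lt_trans.
  rewrite [leRHS](ge0_integral_pushforward mcons _ measurableT)//.
  exact: measurableT_comp.
rewrite [X in fine X](integral_pushforward mcons)// preimage_setT.
rewrite -integral21_prod_meas1//=.
rewrite (_ : (\int[_]_x _)%E = 0%E)//.
apply: integral0_eq => v _.
exact: integral_pder_line.
Qed.

End integral_of_derivative.

(** * The Poincare inequality *)

Section poincare.
Context {R : realType} {n : nat} {Omega : set 'rV[R]_n.+1}.
Hypotheses (mOmega : measurable Omega) (bOmega : bounded_set Omega).
Local Notation Rd := 'rV[R]_n.+1.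
Implicit Types (u w g h k phi psi : Rd -> R).

Lemma weak_pderB i u w g h : L2 Omega u -> L2 Omega w ->
  weak_pder Omega i u g -> weak_pder Omega i w h ->
  weak_pder Omega i (u \- w) (g \- h).
Proof.
move=> u2 w2 [g2 ug] [h2 wh]; split; first exact: L2B.
move=> psi tpsi.
have psi2 := test_function_L2 mOmega bOmega psi tpsi.
have dpsi2 := test_function_pder_L2 mOmega bOmega i psi tpsi.
rewrite -[LHS]/(dotL2 Omega (u \- w) (pder i psi)).
rewrite -[X in - X]/(dotL2 Omega (g \- h) psi) !(dotL2Bl mOmega)//.
by rewrite /dotL2 ug// wh// opprB opprK addrC.
Qed.

(** Integration by parts: phi psi is a test function, so the integral of d_0 (phi psi) is 0. *)
Lemma weak_pder_test_function phi : test_function Omega phi ->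
  weak_pder Omega ord0 phi (pder ord0 phi).
Proof.
move=> tphi; split; first exact: test_function_pder_L2.
move=> psi tpsi; have [[sphi _ _] [spsi _ _]] := (tphi, tpsi).
have phi2 := test_function_L2 mOmega bOmega phi tphi.
have psi2 := test_function_L2 mOmega bOmega psi tpsi.
have dphi2 := test_function_pder_L2 mOmega bOmega ord0 phi tphi.
have dpsi2 := test_function_pder_L2 mOmega bOmega ord0 psi tpsi.
have := Rintegral_pder mOmega bOmega _ (test_functionMl phi psi sphi tpsi).
rewrite pderM; last 2 first.
  by move=> x; exact: smooth_derivable.
  by move=> x; exact: smooth_derivable.
rewrite RintegralD//; last 2 first.
  exact: (L2_integrable_mul mOmega).
  exact: (L2_integrable_mul mOmega).
move/eqP; rewrite addr_eq0 => /eqP ->; congr (- _).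
by apply: eq_Rintegral => x _; rewrite mulrC.
Qed.

Context {M : R}.
Hypotheses (M0 : 0 < M) (OmegaM : forall x, Omega x -> `|x| <= M).

(* Testing the weak derivative k against the test function x_0 phi gives
   - <k, x_0 phi> = <phi, d_0 (x_0 phi)> = |phi|^2 + <x_0 phi, d_0 phi>, and
   the integral of d_0 (x_0 phi^2) being 0, this is |phi|^2 / 2.  No uniqueness
   of weak derivatives is involved. *)
Lemma poincare_test_function phi k : test_function Omega phi ->
  weak_pder Omega ord0 phi k ->
  dotL2 Omega phi phi <= 4 * M ^+ 2 * dotL2 Omega k k.
Proof.
move=> tphi [k2 phik]; have [sphi _ _] := tphi.
pose x0 : Rd -> R := coord ord0; have sx0 : smooth x0 := smooth_coord ord0.
have pder_x0 : pder ord0 x0 = cst 1.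
  by apply/funext => x; rewrite /pder derive_coord mxE.
have dphi x : derivable phi x (delta_mx ord0 ord0) by exact: smooth_derivable.
have dx0 x : derivable x0 x (delta_mx ord0 ord0) by exact: smooth_derivable.
have tx0phi := test_functionMl x0 phi sx0 tphi.
have tphi_sq := test_functionMl phi phi sphi tphi.
have phi2 := test_function_L2 mOmega bOmega phi tphi.
have x0phi2 := test_function_L2 mOmega bOmega _ tx0phi.
have dphi2 := test_function_pder_L2 mOmega bOmega ord0 phi tphi.
have ia := L2_integrable_mul mOmega phi phi phi2 phi2.
have ib := L2_integrable_mul mOmega (x0 * phi) (pder ord0 phi) x0phi2 dphi2.
set A := dotL2 Omega phi phi; pose B := dotL2 Omega (x0 * phi) (pder ord0 phi).
have AB : A + (B + B) = 0.
  rewrite -(Rintegral_pder mOmega bOmega _ (test_functionMl x0 _ sx0 tphi_sq)).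
  rewrite (pderM _ x0 _ dx0 (fun x => derivableM (dphi x) (dphi x))).
  rewrite (pderM _ phi phi dphi dphi) pder_x0 /A /B /dotL2 -RintegralD// -RintegralD//; last first.
    exact: (integrableD mOmega ib ib).
  apply: eq_Rintegral => x _.
  by rewrite !fctE; ring.
have AK : A + B = - dotL2 Omega (x0 * phi) k.
  rewrite (dotL2C (x0 * phi)) /dotL2 -phik// (pderM _ x0 phi dx0 dphi) pder_x0.
  rewrite /A /B /dotL2 -RintegralD//.
  apply: eq_Rintegral => x _.
  by rewrite !fctE; ring.
have x0A : dotL2 Omega (x0 * phi) (x0 * phi) <= M ^+ 2 * A.
  rewrite /A /dotL2 -RintegralZl//; apply: le_Rintegral => //.
  - exact: (L2_integrable_mul mOmega).
  - exact: (integrableZl mOmega (M ^+ 2) ia).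
  move=> x Ox; rewrite !fctE.
  have : `|x0 x| <= M.
    apply: le_trans (OmegaM x Ox); rewrite [leRHS]mx_normrE.
    exact: (le_bigmax _ (fun ij : 'I_1 * 'I_n.+1 => `|x ij.1 ij.2|) (ord0, ord0)).
  rewrite -ler_sqr ?nnegrE ?(ltW M0)// real_normK ?num_real// => x0M.
  rewrite (_ : x0 x * phi x * _ = x0 x ^+ 2 * phi x ^+ 2); last by ring.
  by rewrite -expr2 ler_wpM2r// sqr_ge0.
(* Young's inequality in completed-square form: by D = -A/2 and C <= M^2 A, the weight 2 M^2 gives 0
   <= M^2 A - 2 M^2 A + 4 M^4 K. *)
have := @dotL2_ge0 _ _ Omega (fun x => (x0 * phi) x + 2 * M ^+ 2 * k x).
rewrite (dotL2_quadratic mOmega)//.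
move: x0A AB AK; set C := dotL2 _ _ _; set D := dotL2 _ _ k.
set K := dotL2 _ k k => CA AB AK h.
have M2 : 0 < M ^+ 2 by rewrite exprn_gt0.
have DA : D = - (A / 2) by lra.
rewrite -(ler_pM2l M2); rewrite DA in h.
by nra.
Qed.

Lemma H1_weak_pder i u : H1 Omega u -> weak_pder Omega i u (wpder Omega i u).
Proof. by move=> [_ /(_ i)]; exact: xgetPex. Qed.

Lemma H1norm_sqr_ge u i :
  dotL2 Omega u u + dotL2 Omega (wpder Omega i u) (wpder Omega i u) <=
  H1norm Omega u ^+ 2.
Proof.
rewrite sqr_sqrtr.
  rewrite lerD2l (bigD1 i)//= lerDl; apply: sumr_ge0 => j _.
  exact: dotL2_ge0.
by apply: addr_ge0; [|apply: sumr_ge0 => j _]; exact: dotL2_ge0.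
Qed.

(** Density of test functions. Splitting u = phi + (u - phi), and the derivative of phi as g - h,
    costs a factor 2 each time, which turns 4 M^2 into 16 M^2. *)
Lemma poincare u : H10 Omega u -> dotL2 Omega u u <=
  16 * M ^+ 2 * dotL2 Omega (wpder Omega ord0 u) (wpder Omega ord0 u).
Proof.
move=> [H1u approx]; have [u2 _] := H1u.
set g := wpder Omega ord0 u; have ug := H1_weak_pder ord0 u H1u.
rewrite -/g in ug; have [g2 _] := ug.
(* The total error is 16 M^2 |h|^2 + 2 |u - phi|^2, at most [c] times the squared H^1 distance,
   hence at most [e]. *)
set c := 16 * M ^+ 2 + 2; have M2 : 0 <= M ^+ 2 by rewrite sqr_ge0.
have c0 : 0 < c by rewrite /c; lra.
apply/ler_addgt0Pr => e e0.
have ec0 : 0 < e / c by rewrite divr_gt0.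
have [phi tphi phie] := approx _ (ltac:(by rewrite sqrtr_gt0) : 0 < Num.sqrt (e / c)).
have phi2 := test_function_L2 mOmega bOmega phi tphi.
have uphi2 : L2 Omega (u \- phi) by exact: L2B.
pose h := wpder Omega ord0 (u \- phi).
(* Existence of some weak derivative ensures that [wpder] picks a true one instead of its default 0.
   It may differ from g - d_0 phi on a null set, so g - h is used below as the weak derivative of
   phi. *)
have uphih : weak_pder Omega ord0 (u \- phi) h.
  apply: xgetPex; exists (g \- pder ord0 phi).
  exact: weak_pderB (weak_pder_test_function phi tphi).
have [h2 _] := uphih.
have := H1norm_sqr_ge (u \- phi) ord0; rewrite -/h => H1le.
have H1e : H1norm Omega (u \- phi) ^+ 2 <= e / c.
  rewrite -(sqr_sqrtr (ltW ec0)) ler_sqr ?nnegrE ?sqrtr_ge0//; exact: ltW.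
have phigh : weak_pder Omega ord0 phi (g \- h).
  rewrite (_ : phi = u \- (u \- phi)); first exact: weak_pderB.
  by apply/funext => x /=; ring.
have := poincare_test_function phi _ tphi phigh.
have nh2 := L2Z mOmega (-1) h h2.
have -> : g \- h = g \+ (fun x => -1 * h x) by apply/funext => x /=; ring.
have := dotL2D_le mOmega g _ g2 nh2.
have -> : dotL2 Omega (fun x => -1 * h x) (fun x => -1 * h x) = dotL2 Omega h h.
  by apply: eq_Rintegral => x _; ring.
have := dotL2D_le mOmega phi (u \- phi) phi2 uphi2.
have -> : phi \+ (u \- phi) = u by apply/funext => x /=; ring.
have ecc : c * (e / c) = e by rewrite mulrC divfK// gt_eqF.
move: H1le H1e (@dotL2_ge0 _ _ Omega h) (@dotL2_ge0 _ _ Omega (u \- phi)).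
set hh := dotL2 _ h h; set gg := dotL2 _ g g; set uu := dotL2 _ u u.
set dd := dotL2 _ (u \- phi) (u \- phi); set pp := dotL2 _ phi phi.
set gh := dotL2 _ (g \+ _) _.
move=> h1 h1' hh0 dd0 a1 a2 a3.
have {}h1 : dd + hh <= e / c by exact: le_trans h1 h1'.
have ghM : M ^+ 2 * gh <= M ^+ 2 * (2 * gg + 2 * hh) by exact: ler_wpM2l.
have : c * (dd + hh) <= e by rewrite -[leRHS]ecc ler_wpM2l// ltW.
have : 0 <= M ^+ 2 * dd by exact: mulr_ge0.
rewrite /c; move: (M ^+ 2) M2 ghM a3 => m; nra.
Qed.

End poincare.

(** * Linear spans, and duality between forces and velocities *)

Lemma lspan_trans {R : realType} {d : nat} {V : lmodType R} {k l : nat}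
    (b : 'I_k -> 'rV[R]_d -> V) (phi : 'I_l -> 'rV[R]_d -> V) w :
  (forall i, lspan b (phi i)) -> lspan phi w -> lspan b w.
Proof.
move=> bphi [c ->].
pose a i := sval (cid (bphi i)).
have aE i : phi i = fun x => \sum_j a i j *: b j x by exact: (svalP (cid (bphi i))).
exists (fun j => \sum_i c i * a i j); apply/funext => x.
under [RHS]eq_bigr do rewrite scaler_suml.
rewrite exchange_big/=; apply: eq_bigr => i _; rewrite aE scaler_sumr.
by apply: eq_bigr => j _; rewrite scalerA.
Qed.

Section dual_norm.
Context {R : realType} {n : nat} {Omega : set 'rV[R]_n.+1}.
Hypotheses (mOmega : measurable Omega) (bOmega : bounded_set Omega).
Local Notation Rd := 'rV[R]_n.+1.
Implicit Types (f v : Rd -> Rd).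

Lemma vL2_mL2 v : vL2 Omega v -> mL2 v (Omega := Omega).
Proof. by move=> v2 i j; rewrite (ord1 i). Qed.

Lemma X_mL2 v : X Omega v -> mL2 v (Omega := Omega).
Proof. by move=> Xv; apply: vL2_mL2 => j; case: (Xv j) => -[]. Qed.

Lemma gradE v i j : (fun x => grad Omega v x i j) = wpder Omega i (fun x => v x ord0 j).
Proof. by apply/funext => x; rewrite mxE. Qed.

Lemma X_grad_mL2 v : X Omega v -> mL2 (grad Omega v) (Omega := Omega).
Proof.
move=> Xv i j; rewrite gradE.
by have [] := H1_weak_pder i _ (Xv j).1.
Qed.

Lemma vector_poincare : exists2 C : R, 0 <= C & forall v, X Omega v ->
  mdotL2 Omega v v <= C * mdotL2 Omega (grad Omega v) (grad Omega v).
Proof.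
have [M M0 OM] : exists2 M : R, 0 < M & forall x, Omega x -> `|x| < M.
  exact: ex_strict_bound_gt0 bOmega.
have C0 : 0 <= 16 * M ^+ 2 by rewrite mulr_ge0// sqr_ge0.
exists (16 * M ^+ 2) => //.
move=> v Xv; have v2 := X_mL2 v Xv; have g2 := X_grad_mL2 v Xv.
rewrite !(mdotL2E mOmega)// big_ord1.
apply: (@le_trans _ _ (16 * M ^+ 2 * \sum_j dotL2 Omega
  (fun x => grad Omega v x ord0 j) (fun x => grad Omega v x ord0 j))).
  rewrite mulr_sumr; apply: ler_sum => j _; rewrite gradE.
  by apply: (poincare mOmega bOmega M0) => // x /OM /ltW.
(* Only derivatives in direction 0 were used; the other rows of the gradient add nonnegative
   terms. *)
apply: ler_wpM2l => //; rewrite [leRHS](bigD1 ord0)//= lerDl.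
by apply: sumr_ge0 => i _; apply: sumr_ge0 => j _; exact: dotL2_ge0.
Qed.

(** Contrapositively, a velocity with nonzero pairing is admissible in the set defining
    [dual_norm]. *)
Lemma mdotL2_ae_eq0 f v : vL2 Omega f -> vL2 Omega v ->
  ae_eq (leb n.+1) Omega v (cst 0) -> mdotL2 Omega f v = 0.
Proof.
move=> f2 v2 v0; have [mf2 mv2] := (vL2_mL2 f f2, vL2_mL2 v v2).
rewrite (mdotL2E mOmega)//; apply: big1 => i _; apply: big1 => j _.
rewrite /dotL2 /Rintegral (@ae_eq_integral _ _ _ _ _ (cst 0%E))//.
- by rewrite integral0.
- by apply/measurable_EFinP; apply: measurable_funM; [case: (mf2 i j)|case: (mv2 i j)].
- by apply: filterS v0 => x /= v0 /v0 ->; rewrite mxE mulr0.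
Qed.

Lemma mdotL2_le_dual_norm f v : vL2 Omega f -> X Omega v ->
  mdotL2 Omega f v <> 0 ->
  mdotL2 Omega f v <= dual_norm Omega f * mnormL2 Omega (grad Omega v).
Proof.
move=> f2 Xv fv0; have [C C0 poincareC] := vector_poincare.
have mf2 := vL2_mL2 f f2.
(* Cauchy-Schwarz followed by Poincare: a bound on the quotients uniform in [w], which makes [sup] a
   genuine supremum. *)
have bound w : X Omega w -> mdotL2 Omega f w <=
    Num.sqrt (mdotL2 Omega f f * C) * mnormL2 Omega (grad Omega w).
  move=> Xw; rewrite /mnormL2 -sqrtrM ?mulr_ge0 ?mdotL2_ge0//.
  apply: le_trans (ler_norm _) _; rewrite -sqrtr_sqr ler_wsqrtr//.
  apply: le_trans (mdotL2_cauchy_schwarz mOmega f w mf2 (X_mL2 w Xw)) _.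
  by rewrite -mulrA ler_wpM2l ?mdotL2_ge0// poincareC.
have [gv0|gv0] := eqVneq (mnormL2 Omega (grad Omega v)) 0.
  by have := bound v Xv; rewrite gv0 !mulr0.
have gv_gt0 : 0 < mnormL2 Omega (grad Omega v) by rewrite lt_def gv0 sqrtr_ge0.
rewrite -ler_pdivrMr//; apply: ub_le_sup.
  exists (Num.sqrt (mdotL2 Omega f f * C)) => _ [w [Xw _] <-].
  (* A quotient with zero denominator is 0 by convention. *)
  have [gw0|gw0] := eqVneq (mnormL2 Omega (grad Omega w)) 0.
    by rewrite gw0 invr0 mulr0 sqrtr_ge0.
  rewrite ler_pdivrMr; first exact: bound.
  by rewrite lt_def gw0 sqrtr_ge0.
exists v => //; split => // v0; apply: fv0; apply: mdotL2_ae_eq0 => // j.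
by case: (Xv j) => -[].
Qed.

(** The gap between the right side and 2 D g is ((nu g - D)^2 + 3 D^2) / nu. The gradient term is
    half of the viscous dissipation in one step, up to the factor [dt]. *)
Lemma mdotL2_young_dual_norm (nu : R) f v : 0 < nu -> vL2 Omega f -> X Omega v ->
  2 * mdotL2 Omega f v <=
  nu * mnormL2 Omega (grad Omega v) ^+ 2 + 4 / nu * dual_norm Omega f ^+ 2.
Proof.
move=> nu0 f2 Xv; set g := mnormL2 _ _; set D := dual_norm _ _.
have rhs0 : 0 <= nu * g ^+ 2 + 4 / nu * D ^+ 2.
  by rewrite addr_ge0// mulr_ge0 ?sqr_ge0 ?divr_ge0// ltW.
(* A zero pairing is settled by the sign of the right side; otherwise the dual norm bound
   applies. *)
have [->|/eqP fv0] := eqVneq (mdotL2 Omega f v) 0; first by rewrite mulr0.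
have := mdotL2_le_dual_norm f v f2 Xv fv0; rewrite -/g -/D => fvD.
apply: (@le_trans _ _ (2 * (D * g))); first by rewrite ler_pM2l.
rewrite -subr_ge0 (_ : _ - _ = ((nu * g - D) ^+ 2 + 3 * D ^+ 2) / nu).
  apply: divr_ge0; last exact: ltW.
  by apply: addr_ge0; [exact: sqr_ge0|apply: mulr_ge0 => //; exact: sqr_ge0].
by field; rewrite gt_eqF.
Qed.

End dual_norm.

(** * The energy balance *)

(** The two halves are then the same real number, whether or not the convective integrand is
    integrable. *)
Lemma bstar_skew {R : realType} {d : nat} (Omega : set 'rV[R]_d) w v :
  bstar Omega w v v = 0.
Proof. exact: subrr. Qed.

(** [e] is the energy, [h] the increments, [g] the dissipation, [F] the power of the force and [D]
    its squared dual norm. In the inequality, Young's bound absorbs half of the dissipation. *)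
Lemma energy_telescope {R : realFieldType} (c c' dt : R) (e g h F D : nat -> R) (N : nat) :
  (forall n, e n.+1 + h n + 2 * dt * c * g n = e n + 2 * dt * F n) ->
  (forall n, 2 * dt * F n <= dt * c * g n + c' * D n) ->
  e N + \sum_(0 <= n < N) h n + 2 * dt * c * \sum_(0 <= n < N) g n =
    e 0%N + 2 * dt * \sum_(0 <= n < N) F n /\
  e N + \sum_(0 <= n < N) h n + dt * c * \sum_(0 <= n < N) g n <=
    e 0%N + c' * \sum_(0 <= n < N) D n.
Proof.
move=> step young; split.
  elim: N => [|N IHN]; first by rewrite !big_geq// !mulr0 !addr0.
  by rewrite !big_nat_recr//=; have := step N; lra.
elim: N => [|N IHN]; first by rewrite !big_geq// !mulr0 !addr0.
by rewrite !big_nat_recr//=; have := step N; have := young N; lra.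
Qed.

Theorem theorem4p1 (R : realType) (d : nat) (d23 : d = 2%N \/ d = 3%N)
    (Omega : set 'rV[R]_d) (Omega_domain : bounded_domain Omega)
    (Omega_sobolev : sobolev_embeddings Omega)
    (T : mesh R d) (T_regular : regular_triangulation Omega T)
    (Xh : set ('rV[R]_d -> 'rV[R]_d)) (Qh : set ('rV[R]_d -> R^o))
    (Xh_fe : velocity_fe_space Omega T Xh)
    (Qh_fe : pressure_fe_space Omega T Qh)
    (K L : nat) (uS : 'I_K -> 'rV[R]_d -> 'rV[R]_d) (pS : 'I_L -> 'rV[R]_d -> R^o)
    (uS_Xh : forall k, Xh (uS k)) (pS_Qh : forall l, Qh (pS l))
    (r m : nat) (phi : 'I_r -> 'rV[R]_d -> 'rV[R]_d) (psi : 'I_m -> 'rV[R]_d -> R^o)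
    (phi_POD : POD_basis (mdotL2 Omega (n:=d)) Xh uS phi)
    (psi_POD : POD_basis (dotL2 Omega) Qh pS psi)
    (nu dt eps : R) (nu_gt0 : 0 < nu) (dt_gt0 : 0 < dt) (eps_gt0 : 0 < eps)
    (f : R -> 'rV[R]_d -> 'rV[R]_d)
    (f_L2 : forall n : nat, vL2 Omega (f (n.+1%:R * dt)))
    (u : nat -> 'rV[R]_d -> 'rV[R]_d) (p : nat -> 'rV[R]_d -> R^o)
    (u_XR : forall n, lspan phi (u n)) (p_QM : forall n, lspan psi (p n))
    (momentum : forall n v, lspan phi v ->
      mdotL2 Omega (fun x => dt^-1 *: (u n.+1 x - u n x)) v
      + bstar Omega (u n) (u n.+1) v
      + nu * mdotL2 Omega (grad Omega (u n.+1)) (grad Omega v)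
      - dotL2 Omega (p n.+1) (div Omega v)
      = mdotL2 Omega (f (n.+1%:R * dt)) v)
    (continuity : forall n q, lspan psi q ->
      eps * dotL2 Omega (fun x => dt^-1 *: (p n.+1 x - p n x)) q
      + dotL2 Omega (div Omega (u n.+1)) q = 0) :
  forall N : nat,
    mnormL2 Omega (u N.+1) ^+ 2 + eps * normL2 Omega (p N.+1) ^+ 2
    + \sum_(0 <= n < N.+1) (mnormL2 Omega (u n.+1 \- u n) ^+ 2
                            + eps * normL2 Omega (p n.+1 \- p n) ^+ 2)
    + 2 * dt * nu * \sum_(0 <= n < N.+1) mnormL2 Omega (grad Omega (u n.+1)) ^+ 2
    = mnormL2 Omega (u 0%N) ^+ 2 + eps * normL2 Omega (p 0%N) ^+ 2
      + 2 * dt * \sum_(0 <= n < N.+1) mdotL2 Omega (f (n.+1%:R * dt)) (u n.+1)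
    /\
    mnormL2 Omega (u N.+1) ^+ 2 + eps * normL2 Omega (p N.+1) ^+ 2
    + \sum_(0 <= n < N.+1) (mnormL2 Omega (u n.+1 \- u n) ^+ 2
                            + eps * normL2 Omega (p n.+1 \- p n) ^+ 2)
    + dt * nu * \sum_(0 <= n < N.+1) mnormL2 Omega (grad Omega (u n.+1)) ^+ 2
    <= mnormL2 Omega (u 0%N) ^+ 2 + eps * normL2 Omega (p 0%N) ^+ 2
       + 4 * dt / nu *
         \sum_(0 <= n < N.+1) dual_norm Omega (f (n.+1%:R * dt)) ^+ 2.
Proof.
have [n dE] : exists n, d = n.+1 by case: d23 => ->; [exists 1%N|exists 2%N].
subst d.
have XhE : exists k (b : 'I_k -> 'rV[R]_n.+1 -> 'rV[R]_n.+1), Xh = lspan b.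
  by case: Xh_fe.
have QhE : exists k (b : 'I_k -> 'rV[R]_n.+1 -> R^o), Qh = lspan b by case: Qh_fe.
have [[_ XhX _] [_ QhQ _]] := (Xh_fe, Qh_fe).
(* X_R lies in X_h, a span containing the modes, and X_h lies in X; likewise for the pressure. *)
have Xu k : X Omega (u k).
  apply: XhX; have [l [b Xhb]] := XhE; rewrite Xhb; apply: lspan_trans (u_XR k).
  by move=> i; rewrite -Xhb; case: phi_POD.
have p2 k : L2 Omega (p k).
  suff /QhQ[] : Qh (p k) by [].
  have [l [b Qhb]] := QhE; rewrite Qhb; apply: lspan_trans (p_QM k).
  by move=> i; rewrite -Qhb; case: psi_POD.
have [oOmega _ _ bOmega] := Omega_domain.
have mOmega := open_measurable_rV Omega oOmega.
move=> N; apply: (energy_telescope nu (4 * dt / nu) dt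
  (fun k => mnormL2 Omega (u k) ^+ 2 + eps * normL2 Omega (p k) ^+ 2)
  (fun k => mnormL2 Omega (grad Omega (u k.+1)) ^+ 2)
  (fun k => mnormL2 Omega (u k.+1 \- u k) ^+ 2 +
            eps * normL2 Omega (p k.+1 \- p k) ^+ 2)
  (fun k => mdotL2 Omega (f (k.+1%:R * dt)) (u k.+1))
  (fun k => dual_norm Omega (f (k.+1%:R * dt)) ^+ 2) N.+1) => k.
- have := momentum k _ (u_XR k.+1); have := continuity k _ (p_QM k.+1).
  rewrite bstar_skew addr0 !mnormL2_sqr !normL2_sqr.
  rewrite (dotL2_backward_difference mOmega)//.
  rewrite (mdotL2_backward_difference mOmega); first last.
    exact: X_mL2 (Xu k).
    exact: X_mL2 (Xu k.+1).
  (* By symmetry the two equations share the term [P], which continuity expresses through the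
     pressure energy. *)
  rewrite (dotL2C (div _ _)).
  set P := dotL2 _ _ (div _ _) => pk uk; rewrite -uk.
  have dt0 : dt != 0 by rewrite gt_eqF.
  have -> : P = - (eps * (dt^-1 / 2 * (dotL2 Omega (p k.+1) (p k.+1) -
      dotL2 Omega (p k) (p k) +
      dotL2 Omega (p k.+1 \- p k) (p k.+1 \- p k)))) by lra.
  by field.
- have := mdotL2_young_dual_norm mOmega bOmega nu (f (k.+1%:R * dt)) (u k.+1) nu_gt0
    (f_L2 k) (Xu k.+1).
  rewrite -(ler_pM2l dt_gt0); congr (_ <= _); ring.
Qed.
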